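(* Let $R$ be an associative ring with identity and let $\mathcal{X}$ be a precovering class of left $R$-modules closed under isomorphisms, finite direct sums and direct summands. The following conditions are equivalent for a left $R$-module $M$: (1) $M$ embeds in a module in $\mathcal{X}$. (2) There exists a left $R$-module $M'$ such that ${M'}^{\perp}\subseteq\mathcal{X}^{-1}(M)$. (3) Every injective left $R$-module belongs to $\mathcal{X}^{-1}(M)$. (4) $E(M)\in\mathcal{X}^{-1}(M)$. (5) For any flat right $R$-module $F$, $F^+\in\mathcal{X}^{-1}(M)$.
   Context: Modules are unital left $R$-modules unless stated otherwise. $E(M)$ is the injective envelope of $M$, and $F^+=\mathrm{Hom}_{\mathbb{Z}}(F,\mathbb{Q}/\mathbb{Z})$ is the character module of $F$. For a module $L$, $L^{\perp}=\{N : \mathrm{Ext}^1(L,N)=0\}$. For a class $\mathcal{X}$ of modules, an $\mathcal{X}$-precover of $N$ is a morphism $g:X\to N$ with $X\in\mathcal{X}$ such that $\mathrm{Hom}(X',X)\to\mathrm{Hom}(X',N)$ is surjective for every $X'\in\mathcal{X}$; $\mathcal{X}$ is precovering if every module has an $\mathcal{X}$-precover. The $\mathcal{X}$-precover completing domain $\mathcal{X}^{-1}(M)$ of a module $M$ is the class of all modules $N$ such that for every morphism $f:M\to N$ and every $\mathcal{X}$-precover $g:X\to N$ there is a morphism $h:M\to X$ with $gh=f$. *)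

(* Defs.v *)
From HB Require Import structures.
From mathcomp Require Import all_boot all_order all_algebra ring_quotient.
From mathcomp Require Import boolp.

Set Implicit Arguments.
Unset Strict Implicit.
Unset Printing Implicit Defensive.

Import GRing.Theory.
Local Open Scope ring_scope.

(* A left R-module is an [lmodType R]; a right R-module is an [lmodType R^c],
   with x r written [r *: x]. A class of modules is a predicate on
   [lmodType R]. *)

Section Modules.
Variable R : pzRingType.

Definition surjective_map (A B : Type) (f : A -> B) := forall y, exists x, f x = y.

Definition injective_module (E : lmodType R) :=
  forall (A B : lmodType R) (i : {linear A -> B}) (f : {linear A -> E}),
    injective i -> exists g : {linear B -> E}, forall x, g (i x) = f x.

Definition projective_module (P : lmodType R) :=
  forall (A B : lmodType R) (p : {linear A -> B}) (f : {linear P -> B}),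
    surjective_map p -> exists g : {linear P -> A}, forall x, p (g x) = f x.

Definition essential_mono (M E : lmodType R) (i : {linear M -> E}) :=
  injective i /\
  forall S : {pred E}, submod_closed S -> (exists2 x, x \in S & x != 0) ->
    exists2 m, i m \in S & i m != 0.

Definition injective_envelope (M E : lmodType R) (i : {linear M -> E}) :=
  injective_module E /\ essential_mono i.

Record proj_resolution (L : lmodType R) := ProjResolution {
  res_mod : nat -> lmodType R;
  res_diff : forall n, {linear res_mod n.+1 -> res_mod n};
  res_aug : {linear res_mod 0%N -> L};
  res_proj : forall n, projective_module (res_mod n);
  res_aug_surj : surjective_map res_aug;
  res_exact0 : forall x, res_aug x = 0 <-> exists y, res_diff 0%N y = x;
  res_exact : forall n x,
    res_diff n x = 0 <-> exists y, res_diff n.+1 y = x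
}.

(* Ext^1(L, N) = H^1(Hom(P, N)) for a projective resolution P of L, so it
   vanishes when all 1-cocycles are 1-coboundaries; this does not depend on
   the choice of P. *)
Definition Ext1_eq0 (L N : lmodType R) :=
  forall (P : proj_resolution L) (c : {linear res_mod P 1%N -> N}),
    (forall x, c (res_diff P 1%N x) = 0) ->
    exists b : {linear res_mod P 0%N -> N}, forall x, c x = b (res_diff P 0%N x).

Definition perp (L : lmodType R) : lmodType R -> Prop := fun N => Ext1_eq0 L N.

Definition iso_modules (A B : lmodType R) :=
  exists f : {linear A -> B}, bijective f.

Definition is_direct_sum n (A : 'I_n -> lmodType R) (S : lmodType R) :=
  exists (inj : forall i, {linear A i -> S}) (prj : forall i, {linear S -> A i}),
    [/\ forall i x, prj i (inj i x) = x,
        forall i j x, i != j -> prj i (inj j x) = 0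
      & forall s, \sum_(i < n) inj i (prj i s) = s].

Definition direct_summand (A S : lmodType R) :=
  exists B : lmodType R, iso_modules (A * B)%type S.

Section Classes.
Variable X : lmodType R -> Prop.

Definition closed_iso := forall A B, iso_modules A B -> X A -> X B.

Definition closed_finite_direct_sums :=
  forall n (A : 'I_n -> lmodType R) S,
    is_direct_sum A S -> (forall i, X (A i)) -> X S.

Definition closed_direct_summands := forall A S, direct_summand A S -> X S -> X A.

Definition is_precover (X0 N : lmodType R) (g : {linear X0 -> N}) :=
  X X0 /\
  forall X' : lmodType R, X X' -> forall f : {linear X' -> N},
    exists h : {linear X' -> X0}, forall x, g (h x) = f x.

Definition precovering :=
  forall N : lmodType R,
    exists (X0 : lmodType R) (g : {linear X0 -> N}), is_precover g.

Definition completing_domain (M N : lmodType R) :=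
  forall (f : {linear M -> N}) (X0 : lmodType R) (g : {linear X0 -> N}),
    is_precover g -> exists h : {linear M -> X0}, forall x, g (h x) = f x.

End Classes.

Section Tensor.
Variables (F : lmodType R^c) (A : lmodType R).

Definition balanced (T : zmodType) (t : F -> A -> T) :=
  [/\ forall x y a, t (x + y) a = t x a + t y a,
      forall x a b, t x (a + b) = t x a + t x b
    & forall (r : R) x a, t ((r : R^c) *: x) a = t x (r *: a)].

Definition is_tensor (T : zmodType) (t : F -> A -> T) :=
  balanced t /\
  forall (U : zmodType) (b : F -> A -> U), balanced b ->
    exists u : {additive T -> U}, (forall x a, u (t x a) = b x a) /\
      forall v : {additive T -> U}, (forall x a, v (t x a) = b x a) -> v =1 u.

End Tensor.

(* [g] is the map F (x) f, and the tensor products are determined up to a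
   unique isomorphism by [is_tensor]. *)
Definition flat (F : lmodType R^c) :=
  forall (A B : lmodType R) (f : {linear A -> B}), injective f ->
  forall (TA TB : zmodType) (tA : F -> A -> TA) (tB : F -> B -> TB),
    is_tensor tA -> is_tensor tB ->
  forall g : {additive TA -> TB},
    (forall x a, g (tA x a) = tB x (f a)) -> injective g.

End Modules.

Definition rat_int : {pred rat} := [pred x | x \is a Num.int].

Lemma rat_int_zmod_closed : zmod_closed rat_int.
Proof. by split=> [|x y]; rewrite !inE ?rpred0 //; apply: rpredB. Qed.

HB.instance Definition _ :=
  GRing.isZmodClosed.Build rat rat_int rat_int_zmod_closed.

Definition QmodZ : zmodType := Quotient.quot rat_int.

Definition character (R : pzRingType) (F : lmodType R^c) : Type :=
  {additive F -> QmodZ}.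

Section CharacterModule.
Variables (R : pzRingType) (F : lmodType R^c).
Local Notation chF := (character F).

HB.instance Definition _ := gen_eqMixin chF.
HB.instance Definition _ := gen_choiceMixin chF.

Definition char_fun (f : chF) : F -> QmodZ := f : {additive F -> QmodZ}.

Lemma charP (f g : chF) : char_fun f =1 char_fun g -> f = g.
Proof.
case: f g => [f [[fA]]] [g [[gA]]] /funext efg; rewrite /char_fun /= in efg.
by case: _ / efg gA => gA; rewrite (Prop_irrelevance fA gA).
Qed.

Definition char_zero : chF := \0 : {additive F -> QmodZ}.
Definition char_opp (f : chF) : chF := \- char_fun f : {additive F -> QmodZ}.
Definition char_add (f g : chF) : chF :=
  char_fun f \+ char_fun g : {additive F -> QmodZ}.

Lemma char_addA : associative char_add.
Proof. by move=> f g h; apply: charP => x; exact: addrA. Qed.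

Lemma char_addC : commutative char_add.
Proof. by move=> f g; apply: charP => x; exact: addrC. Qed.

Lemma char_add0 : left_id char_zero char_add.
Proof. by move=> f; apply: charP => x; exact: add0r. Qed.

Lemma char_addN : left_inverse char_zero char_opp char_add.
Proof. by move=> f; apply: charP => x; exact: addNr. Qed.

HB.instance Definition _ :=
  GRing.isZmodule.Build chF char_addA char_addC char_add0 char_addN.

(* (r f)(x) = f(x r) *)
Definition char_scale_fun (r : R) (f : chF) (x : F) : QmodZ :=
  char_fun f ((r : R^c) *: x).

Lemma char_scale_additive r f : nmod_morphism (char_scale_fun r f).
Proof.
by split=> [|x y]; rewrite /char_scale_fun /char_fun ?scaler0 ?raddf0 // scalerDr raddfD.
Qed.

HB.instance Definition _ r f := GRing.isNmodMorphism.Build F QmodZ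
  (char_scale_fun r f) (char_scale_additive r f).

Definition char_scale (r : R) (f : chF) : chF :=
  char_scale_fun r f : {additive F -> QmodZ}.

Lemma char_scaleA (r s : R) (f : chF) :
  char_scale r (char_scale s f) = char_scale (r * s) f.
Proof.
by apply: charP => x; congr (char_fun f _); exact: scalerA.
Qed.

Lemma char_scale1 : left_id 1 char_scale.
Proof. by move=> f; apply: charP => x; congr (char_fun f _); exact: scale1r. Qed.

Lemma char_scaleDr : right_distributive char_scale +%R.
Proof. by move=> r f g; exact: charP. Qed.

Lemma char_scaleDl (f : chF) : {morph char_scale^~ f : r s / r + s}.
Proof.
move=> r s; apply: charP => x.
transitivity (char_fun f ((r : R^c) *: x + (s : R^c) *: x)).
  by congr (char_fun f _); exact: scalerDl.
exact: raddfD.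
Qed.

HB.instance Definition _ := GRing.Zmodule_isLmodule.Build R chF
  char_scaleA char_scale1 char_scaleDr char_scaleDl.

End CharacterModule.

(* Main.v *)
Require Import Defs.
From HB Require Import structures.
From mathcomp Require Import all_boot all_order all_algebra.
From mathcomp Require Import generic_quotient ring_quotient boolp classical_sets.

(* If M embeds in X0 in X, then Ext^1(X0/M, N) = 0 lets every map M -> N extend to
   X0, and a map from X0 lifts along any precover of N; injective modules are
   Ext-orthogonal to everything. Conversely, when an embedding j of M into a module
   in the precover completing domain lifts along a precover g : X0 -> E, the lift
   is itself an embedding of M into X0. What remains is to embed M into such a
   module: F^+ is injective for F flat, since F (x) - preserves injections and Q/Z
   is an injective abelian group; M embeds in F^+ for F free on the set M^+, since
   characters separate points; and E(M) is cut out of F^+ as a direct summand. *)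

Set Implicit Arguments.
Unset Strict Implicit.
Unset Printing Implicit Defensive.

Import GRing.Theory.
Local Open Scope ring_scope.
Local Open Scope quotient_scope.

(** * Bundled maps, submodules and quotient modules *)

Definition mk_linear (R : pzRingType) (A B : lmodType R) (f : A -> B)
    (fL : linear f) : {linear A -> B} :=
  HB.pack f (GRing.isLinear.Build R A B *:%R f fL).

Definition mk_additive (A B : zmodType) (f : A -> B)
    (fD : {morph f : x y / x + y}) : {additive A -> B}.
Proof.
apply: (HB.pack f (GRing.isNmodMorphism.Build A B f _)); split => //.
by apply: (addrI (f 0)); rewrite -fD !addr0.
Defined.

Section SubQuotient.
Variables (R : pzRingType) (V : lmodType R).

Record submodule := Submodule {
  submod_pred :> {pred V};
  submod_predP : submod_closed submod_pred
}.

HB.instance Definition _ (S : submodule) := GRing.isSubmodClosed.Build R V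
  (submod_pred S) (GRing.submod_closed_semi (submod_predP S)).

Variable S : submodule.

Definition submod : Type := {x : V | x \in S}.
HB.instance Definition _ := SubChoice.on submod.
HB.instance Definition _ := [SubChoice_isSubLmodule of submod by <:].

Definition submod_incl : {linear submod -> V} :=
  mk_linear (linearP (val : {linear submod -> V})).

Lemma submod_incl_inj : injective submod_incl.
Proof. exact: val_inj. Qed.

Lemma submod_inclP (x : submod) : submod_incl x \in S.
Proof. exact: valP. Qed.

Lemma submod_corestrict (A : lmodType R) (f : {linear A -> V}) :
  (forall x, f x \in S) ->
  exists g : {linear A -> submod}, forall x, submod_incl (g x) = f x.
Proof.
move=> fS; have gL : linear (fun x => exist _ (f x) (fS x) : submod).
  by move=> a x y; apply: val_inj; rewrite /= linearP.
by exists (mk_linear gL).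
Qed.

Definition quotmod : Type := Quotient.quot (submod_pred S).
HB.instance Definition _ := GRing.Zmodule.on quotmod.
Definition quot_pi (x : V) : quotmod := \pi_(Quotient.quot (submod_pred S)) x.
Definition quot_scale (r : R) (q : quotmod) : quotmod :=
  quot_pi (r *: repr (q : Quotient.quot (submod_pred S))).

Lemma quot_pi_eq x y : (quot_pi x = quot_pi y) <-> x - y \in S.
Proof. by rewrite Quotient.idealrBE; split=> [xy|/eqP//]; apply/eqP. Qed.

Lemma quot_pi_surj : surjective_map quot_pi.
Proof. by move=> q; exists (repr (q : Quotient.quot (submod_pred S))); rewrite /quot_pi reprK. Qed.

Lemma quot_piD : {morph quot_pi : x y / x + y}.
Proof. by move=> x y; rewrite /quot_pi [LHS]pi_addr. Qed.

(** Elements of one coset differ by an element of [S], and [S] is stable under scalars, so the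
    representative chosen in [quot_scale] does not matter. The module axioms then descend along
    [quot_pi]. *)
Lemma quot_piZ r x : quot_pi (r *: x) = quot_scale r (quot_pi x).
Proof.
apply/quot_pi_eq; rewrite -scalerBr; apply/rpredZ/quot_pi_eq.
by rewrite /quot_pi reprK.
Qed.

Lemma quot_scaleA a b q : quot_scale a (quot_scale b q) = quot_scale (a * b) q.
Proof. by have [x <-] := quot_pi_surj q; rewrite -!quot_piZ scalerA. Qed.

Lemma quot_scale1 : left_id 1 quot_scale.
Proof. by move=> q; have [x <-] := quot_pi_surj q; rewrite -quot_piZ scale1r. Qed.

Lemma quot_scaleDr : right_distributive quot_scale +%R.
Proof.
move=> r q q'; have [x <-] := quot_pi_surj q; have [y <-] := quot_pi_surj q'.
by rewrite -!quot_piZ -!quot_piD -quot_piZ scalerDr.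
Qed.

Lemma quot_scaleDl q : {morph quot_scale^~ q : a b / a + b}.
Proof.
by have [x <-] := quot_pi_surj q => a b; rewrite -!quot_piZ -quot_piD scalerDl.
Qed.

HB.instance Definition _ := GRing.Zmodule_isLmodule.Build R quotmod
  quot_scaleA quot_scale1 quot_scaleDr quot_scaleDl.

Lemma quot_pi_linear : linear quot_pi.
Proof. by move=> a x y; rewrite quot_piD quot_piZ. Qed.

Definition quot_proj : {linear V -> quotmod} := mk_linear quot_pi_linear.

Lemma quot_proj_surj : surjective_map quot_proj.
Proof. exact: quot_pi_surj. Qed.

Lemma quot_proj_eq0 x : quot_proj x = 0 <-> x \in S.
Proof. by rewrite -(linear0 quot_proj) -{2}[x]subr0; apply: quot_pi_eq. Qed.

End SubQuotient.

Definition lin_kernel (R : pzRingType) (A B : lmodType R) (f : {linear A -> B}) :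
  submodule A.
Proof.
apply: (@Submodule R A [pred x | f x == 0]).
split=> [|a x y]; rewrite !inE ?linear0 // => /eqP fx /eqP fy.
by rewrite linearP fx fy scaler0 addr0.
Defined.

Definition lin_image (R : pzRingType) (A B : lmodType R) (f : {linear A -> B}) :
  submodule B.
Proof.
apply: (@Submodule R B (fun y => `[< exists x, f x = y >])).
split=> [|a _ _ /asboolP[x <-] /asboolP[y <-]]; apply/asboolP.
  by exists 0; rewrite linear0.
by exists (a *: x + y); rewrite linearP.
Defined.

Lemma in_lin_kernel (R : pzRingType) (A B : lmodType R) (f : {linear A -> B}) x :
  (x \in lin_kernel f) = (f x == 0).
Proof. by []. Qed.

Lemma in_lin_image (R : pzRingType) (A B : lmodType R) (f : {linear A -> B}) y :
  y \in lin_image f <-> exists x, f x = y.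
Proof. by split=> /asboolP. Qed.

(* The module generated by [G] that is universal for a class [Adm] of maps from
   [G] to modules: formal R-linear combinations of generators, two of them being
   identified when no admissible map separates them. *)
Section Presented.
Variables (R : pzRingType) (G : choiceType).
Variable Adm : forall U : lmodType R, (G -> U) -> Prop.

Definition comb_eval (U : lmodType R) (h : G -> U) (w : seq (R * G)) : U :=
  \sum_(p <- w) p.1 *: h p.2.

Definition comb_equiv (w w' : seq (R * G)) : bool :=
  `[< forall (U : lmodType R) (h : G -> U), Adm h ->
        comb_eval h w = comb_eval h w' >].

Lemma comb_equiv_class : equiv_class_of comb_equiv.
Proof.
split=> [w|w w'|w2 w1 w3]; first exact/asboolP.
  by apply/asbool_equiv_eq; split=> e U h /e.
move=> /asboolP e /asboolP e'; apply/asboolP => U h Ah.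
by rewrite e // e'.
Qed.

Canonical comb_equiv_rel := EquivRelPack comb_equiv_class.
Canonical comb_equiv_enc := defaultEncModRel comb_equiv.

Definition presented : Type := {eq_quot comb_equiv}.
HB.instance Definition _ := Choice.on presented.

Definition presented_pi (w : seq (R * G)) : presented :=
  \pi_({eq_quot comb_equiv}) w.
Definition presented_repr (q : presented) : seq (R * G) :=
  repr (q : {eq_quot comb_equiv}).

Definition presented_eval (U : lmodType R) (h : G -> U) (q : presented) : U :=
  comb_eval h (presented_repr q).

Lemma presented_eval_pi (U : lmodType R) (h : G -> U) w :
  Adm h -> presented_eval h (presented_pi w) = comb_eval h w.
Proof.
move=> Ah; have : presented_pi (presented_repr (presented_pi w)) = presented_pi w.
  exact: reprK.
by move=> /eqquotP/asboolP; apply.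
Qed.

(** Reduces each module law below to the same law in the targets [U], so that no congruence
    generated by relations has to be handled. *)
Lemma presented_ext (q q' : presented) :
  (forall (U : lmodType R) (h : G -> U), Adm h ->
     presented_eval h q = presented_eval h q') -> q = q'.
Proof.
move=> e; rewrite -[q]reprK -[q']reprK; apply/eqquotP/asboolP => U h Ah.
exact: e.
Qed.

Definition presented_zero : presented := presented_pi [::].
Definition presented_add (q q' : presented) : presented :=
  presented_pi (presented_repr q ++ presented_repr q').
Definition presented_scale (r : R) (q : presented) : presented :=
  presented_pi [seq (r * p.1, p.2) | p <- presented_repr q].
Definition presented_opp (q : presented) : presented := presented_scale (-1) q.

Section Eval.
Variables (U : lmodType R) (h : G -> U).
Hypothesis Ah : Adm h.

Lemma presented_eval0 : presented_eval h presented_zero = 0.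
Proof. by rewrite presented_eval_pi // /comb_eval big_nil. Qed.

Lemma presented_evalD q q' :
  presented_eval h (presented_add q q') =
  presented_eval h q + presented_eval h q'.
Proof. by rewrite presented_eval_pi // /comb_eval big_cat. Qed.

Lemma presented_evalZ r q :
  presented_eval h (presented_scale r q) = r *: presented_eval h q.
Proof.
rewrite presented_eval_pi // /comb_eval big_map scaler_sumr.
by apply: eq_bigr => p _; rewrite scalerA.
Qed.

Lemma presented_evalN q : presented_eval h (presented_opp q) = - presented_eval h q.
Proof. by rewrite presented_evalZ scaleN1r. Qed.

End Eval.

Lemma presented_addA : associative presented_add.
Proof.
by move=> p q r; apply: presented_ext => U h Ah; rewrite !presented_evalD ?addrA.
Qed.

Lemma presented_addC : commutative presented_add.
Proof.
by move=> p q; apply: presented_ext => U h Ah; rewrite !presented_evalD // addrC.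
Qed.

Lemma presented_add0 : left_id presented_zero presented_add.
Proof.
move=> p; apply: presented_ext => U h Ah.
by rewrite presented_evalD // presented_eval0 // add0r.
Qed.

Lemma presented_addN : left_inverse presented_zero presented_opp presented_add.
Proof.
move=> p; apply: presented_ext => U h Ah.
by rewrite presented_evalD // presented_evalN // presented_eval0 // addNr.
Qed.

HB.instance Definition _ := GRing.isZmodule.Build presented
  presented_addA presented_addC presented_add0 presented_addN.

Lemma presented_scaleA a b q :
  presented_scale a (presented_scale b q) = presented_scale (a * b) q.
Proof.
by apply: presented_ext => U h Ah; rewrite !presented_evalZ // scalerA.
Qed.

Lemma presented_scale1 : left_id 1 presented_scale.
Proof.
by move=> q; apply: presented_ext => U h Ah; rewrite presented_evalZ // scale1r.
Qed.

Lemma presented_scaleDr : right_distributive presented_scale +%R.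
Proof.
move=> a p q; apply: presented_ext => U h Ah.
by rewrite !(presented_evalD, presented_evalZ) // scalerDr.
Qed.

Lemma presented_scaleDl q : {morph presented_scale^~ q : a b / a + b}.
Proof.
move=> a b; apply: presented_ext => U h Ah.
by rewrite !(presented_evalD, presented_evalZ) // scalerDl.
Qed.

HB.instance Definition _ := GRing.Zmodule_isLmodule.Build R presented
  presented_scaleA presented_scale1 presented_scaleDr presented_scaleDl.

Definition presented_gen (g : G) : presented := presented_pi [:: (1, g)].

Lemma presented_eval_linear (U : lmodType R) (h : G -> U) :
  Adm h -> linear (presented_eval h : presented -> U).
Proof. by move=> Ah a p q; rewrite presented_evalD // presented_evalZ. Qed.

Definition presented_map (U : lmodType R) (h : G -> U) (Ah : Adm h) :
  {linear presented -> U} := mk_linear (presented_eval_linear Ah).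

Lemma presented_mapE (U : lmodType R) (h : G -> U) (Ah : Adm h) g :
  presented_map Ah (presented_gen g) = h g.
Proof.
by rewrite [LHS]presented_eval_pi // /comb_eval big_seq1 scale1r.
Qed.

Lemma presented_map_ext (q q' : presented) :
  (forall (U : lmodType R) (h : G -> U) (Ah : Adm h),
     presented_map Ah q = presented_map Ah q') -> q = q'.
Proof. by move=> e; apply: presented_ext => U h Ah; apply: (e U h Ah). Qed.

Lemma presented_sum (q : presented) :
  exists w : seq (R * G), q = \sum_(p <- w) p.1 *: presented_gen p.2.
Proof.
exists (presented_repr q); apply: presented_map_ext => U h Ah.
rewrite linear_sum; apply: eq_bigr => p _.
by rewrite linearZ presented_mapE.
Qed.

End Presented.

(** * Free modules and their projectivity *)

Section Free.
Variables (R : pzRingType) (G : choiceType).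

(** Admitting every map imposes no relation beyond the module axioms. *)
Definition free_mod : lmodType R := presented (fun (U : lmodType R) (_ : G -> U) => True).
Definition free_gen (g : G) : free_mod := presented_gen _ g.

Definition free_map (U : lmodType R) (h : G -> U) : {linear free_mod -> U} :=
  @presented_map R G (fun _ _ => True) U h I.

Lemma free_mapE (U : lmodType R) (h : G -> U) g : free_map h (free_gen g) = h g.
Proof. exact: presented_mapE. Qed.

Lemma free_sum (x : free_mod) :
  exists w : seq (R * G), x = \sum_(p <- w) p.1 *: free_gen p.2.
Proof. exact: presented_sum. Qed.

Lemma free_linear_ext (U : lmodType R) (f f' : {linear free_mod -> U}) :
  (forall g, f (free_gen g) = f' (free_gen g)) -> f =1 f'.
Proof.
move=> e x; have [w ->] := free_sum x.
by rewrite !linear_sum; apply: eq_bigr => k _; rewrite !linearZ e.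
Qed.

Lemma free_projective : projective_module free_mod.
Proof.
move=> A B p f p_surj; have [h hE] := choice (fun g => p_surj (f (free_gen g))).
exists (free_map h); apply: (@free_linear_ext _ (p \o free_map h)%FUN) => g.
by rewrite -hE; congr (p _); apply: free_mapE.
Qed.

End Free.

(** * Free resolutions by iterated syzygies *)

Section Resolution.
Variable R : pzRingType.

Definition free_cover (L : lmodType R) : {linear free_mod R L -> L} :=
  free_map (id : L -> L).

Lemma free_cover_surj L : surjective_map (free_cover L).
Proof. by move=> x; exists (free_gen R x); rewrite free_mapE. Qed.

Definition syzygy (L : lmodType R) : lmodType R := submod (lin_kernel (free_cover L)).

Definition syzygy_cover (L : lmodType R) :
    {linear free_mod R (syzygy L) -> free_mod R L} :=
  (submod_incl _ \o free_cover (syzygy L))%FUN.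

Lemma free_cover_exact L x :
  free_cover L x = 0 <-> exists y, syzygy_cover L y = x.
Proof.
split=> [/eqP x0|[y <-]]; last first.
  by apply/eqP; rewrite -in_lin_kernel; apply: submod_inclP.
have [y ey] := free_cover_surj (exist _ x x0 : syzygy L).
by exists y; apply: (congr1 (submod_incl _) ey).
Qed.

(** The inclusion of the syzygy is injective, so [syzygy_cover L] has the same kernel as
    [free_cover (syzygy L)], to which [free_cover_exact] applies. *)
Lemma syzygy_cover_exact L x :
  syzygy_cover L x = 0 <-> exists y, syzygy_cover (syzygy L) y = x.
Proof.
rewrite -free_cover_exact; have i0 := linear0 (submod_incl (lin_kernel (free_cover L))).
split=> [x0|x0]; first by apply: submod_incl_inj; rewrite [RHS]i0.
by rewrite -i0 -x0.
Qed.

(** [Ext1_eq0] quantifies over all resolutions, so a hypothesis of this form can be exploited only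
    once some resolution is at hand. *)
Lemma proj_resolution_exists (L : lmodType R) : exists P : proj_resolution L, True.
Proof.
pose syz n := iter n syzygy L.
by exists (@ProjResolution R L (fun n => free_mod R (syz n))
  (fun n => syzygy_cover (syz n)) (free_cover L)
  (fun n => @free_projective R _) (@free_cover_surj L)
  (@free_cover_exact L) (fun n => @syzygy_cover_exact (syz n))).
Qed.

End Resolution.

(** * Factorization of linear maps and vanishing of Ext *)

Section Factor.
Variable R : pzRingType.
Implicit Types A B C N : lmodType R.

(** A set-theoretic section [r] of [s] suffices: [t] agrees on elements with equal image under [s],
    which also makes [t] after [r] linear. *)
Lemma linear_factor_surj A B N (s : {linear A -> B}) (t : {linear A -> N}) :
  surjective_map s -> (forall x, s x = 0 -> t x = 0) ->
  exists g : {linear B -> N}, forall x, g (s x) = t x.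
Proof.
move=> s_surj st; have [r rK] := choice s_surj.
have tr x y : s x = s y -> t x = t y.
  by move=> /eqP; rewrite -subr_eq0 -linearB => /eqP/st/eqP; rewrite linearB subr_eq0 => /eqP.
have gL : linear (fun y => t (r y)).
  by move=> a x y; rewrite -linearP; apply: tr; rewrite linearP !rK.
by exists (mk_linear gL) => x; apply: tr; rewrite rK.
Qed.

Lemma linear_factor_inj A B C (i : {linear A -> B}) (f : {linear C -> B}) :
  injective i -> (forall x, exists a, i a = f x) ->
  exists g : {linear C -> A}, forall x, i (g x) = f x.
Proof.
move=> i_inj /choice[g gE].
have gL : linear g by move=> a x y; apply: i_inj; rewrite linearP !gE linearP.
by exists (mk_linear gL).
Qed.

Definition copair A B N (f : {linear A -> N}) (g : {linear B -> N}) :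
  {linear (A * B)%type -> N}.
Proof.
apply: (@mk_linear _ _ _ (fun z : A * B => f z.1 + g z.2)).
by move=> a x y; rewrite /= !linearP scalerDr addrACA.
Defined.

(** For a resolution P of B/A, lift the augmentation to [l] from P_0 to [B]. On P_1, l d factors
    through [i] as [k], and f k is a cocycle, hence of the form b d. As [B] is a quotient of A x P_0
    by way of [i] and [l], the maps [f] and [b] glue to a map on [B]. *)
Lemma Ext1_extension A B N (i : {linear A -> B}) (f : {linear A -> N}) :
  injective i -> Ext1_eq0 (quotmod (lin_image i)) N ->
  exists g : {linear B -> N}, forall x, g (i x) = f x.
Proof.
move=> i_inj extN; have [P _] := proj_resolution_exists (quotmod (lin_image i)).
have [l lE] := res_proj (res_aug P) (@quot_proj_surj _ _ (lin_image i)).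
have augd y : res_aug P (res_diff P 0 y) = 0 by apply/res_exact0; exists y.
have dd y : res_diff P 0 (res_diff P 1 y) = 0 by apply/res_exact; exists y.
have [y|k kE] := @linear_factor_inj _ _ _ i (l \o res_diff P 0%N)%FUN i_inj.
  by apply/in_lin_image/quot_proj_eq0; rewrite lE augd.
have [y|b bE] := extN P (f \o k)%FUN.
  rewrite /= (_ : k _ = 0) ?linear0 //.
  by apply: i_inj; rewrite linear0 kE /= dd linear0.
have [x|[a p] /= e0|g gE] := @linear_factor_surj _ _ _ (copair i l) (copair f b).
- have [p pE] := res_aug_surj P (quot_proj (lin_image i) x).
  have /quot_proj_eq0/in_lin_image[a aE] : quot_proj (lin_image i) (x - l p) = 0.
    by rewrite linearB lE pE subrr.
  by exists (a, p); rewrite /= aE subrK.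
- have /res_exact0[y yp] : res_aug P p = 0.
    rewrite -lE; apply/quot_proj_eq0/in_lin_image; exists (- a).
    by apply/eqP; rewrite linearN eq_sym -addr_eq0 addrC; apply/eqP.
  have -> : a = - k y.
    by apply: i_inj; apply/eqP; rewrite linearN kE /= yp -addr_eq0; apply/eqP.
  by rewrite linearN /= [f (k y)]bE yp addNr.
exists g => a; have := gE (a, 0).
by rewrite /= !linear0 !addr0.
Qed.

(** A cocycle vanishes on the kernel of [d], so it factors through the image of [d] in P_0, and
    injectivity extends it from there to P_0. *)
Lemma injective_Ext1_eq0 A N : injective_module N -> Ext1_eq0 A N.
Proof.
move=> Ninj P c cd; set d := res_diff P 0%N.
have [x|d' d'E] := @submod_corestrict _ _ (lin_image d) _ d.
  by apply/in_lin_image; exists x.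
have [[y yd]|x d'x|c' c'E] := @linear_factor_surj _ _ _ d' c.
- have /in_lin_image[x xy] := yd; exists x.
  by apply: submod_incl_inj; rewrite d'E.
- have /res_exact[y <-] // : res_diff P 0%N x = 0.
  by rewrite -/d -d'E d'x linear0.
have [b bE] := Ninj _ _ (submod_incl (lin_image d)) c' (@submod_incl_inj _ _ _).
by exists b => x; rewrite -/d -d'E bE c'E.
Qed.

End Factor.

(** * Maximal submodules meeting a given set trivially *)

Section Zorn.
Local Open Scope classical_set_scope.
Variables (R : pzRingType) (V : lmodType R).

Definition meets_trivially (A B : {pred V}) :=
  forall x, x \in A -> x \in B -> x = 0.

Lemma maximal_submodule (A : submodule V) (B : {pred V}) :
  meets_trivially A B ->
  exists C : submodule V, [/\ {subset A <= C}, meets_trivially C B &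
    forall D : submodule V, {subset C <= D} -> meets_trivially D B ->
      {subset D <= C}].
Proof.
move=> AB; pose good (C : submodule V) := {subset A <= C} /\ meets_trivially C B.
pose P (S : set V) := S = set0 \/ exists2 C : submodule V, good C & S = [set` C].
have [F FP Ftot|S [[->|[C [AC CB] ->]] Smax]] := @Zorn_bigcup V P.
- have [[S FS [C0 [AC0 C0B] SE]]|noF] := pselect (exists2 S, F S &
      exists2 C, good C & S = [set` C]); last first.
    left; rewrite -subset0 => x [S FS Sx]; case: (FP S FS) => [S0|SC].
      by rewrite S0 in Sx.
    by case: noF; exists S.
  (* [D] is the union of the chain. It contains 0 thanks to the member [C0], and any two of its
     elements lie in a common member. *)
  right; pose D : {pred V} := fun x => `[< exists2 S, F S & S x >].
  have DP x : x \in D -> exists2 C : submodule V, good C /\ F [set` C] & x \in C.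
    move=> /asboolP[T FT Tx]; case: (FP T FT) => [T0|[C gC TC]].
      by rewrite T0 in Tx.
    by move: Tx FT; rewrite TC => xC FC; exists C.
  have DC (C : submodule V) x : F [set` C] -> x \in C -> x \in D.
    by move=> FC xC; apply/asboolP; exists [set` C].
  have subD : submod_closed D.
    rewrite SE in FS; split=> [|a x y]; first exact: (DC C0) (rpred0 _).
    move=> /DP[C1 [_ F1] x1] /DP[C2 [_ F2] y2].
    case: (Ftot _ _ F1 F2) => sub.
      by apply: (DC C2) => //; rewrite rpredD // rpredZ //; apply: (sub x).
    by apply: (DC C1) => //; rewrite rpredD // ?rpredZ //; apply: (sub y).
  exists (Submodule subD); first split.
  + by move=> x /AC0; apply: DC; rewrite -SE.
  + by move=> x /DP[C [[_ CB] _] xC]; apply: CB.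
  by apply/seteqP; split=> x /asboolP.
- case: (Smax [set` A]); last by right; exists A; [split|].
  split=> [//|/(_ 0)]; apply; exact: rpred0.
exists C; split=> // D CD DB x xD; apply: contrapT => xC.
case: (Smax [set` D]); last by right; exists D => //; split=> // y /AC/CD.
by split=> [//|/(_ x xD)].
Qed.

End Zorn.

(** * Injective envelopes inside an injective module *)

Section Envelope.
Variable R : pzRingType.

(* With [K] maximal avoiding the image of [M] and [L] maximal avoiding [K], the
   projection of K + L onto K extends to an endomorphism [g] of the injective
   module [E]. Maximality of [L] forces [ker g = L], and maximality of [K] forces
   [im g = K], so that [E] is the direct sum of [K] and [L] and [L] is injective. *)
Lemma injective_envelope_exists (M E : lmodType R) (j : {linear M -> E}) :
  injective_module E -> injective j ->
  exists (L : lmodType R) (i : {linear M -> L}), injective_envelope i.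
Proof.
move=> Einj j_inj.
have zeroP : submod_closed (pred1 (0 : E)).
  by split=> [|a x y /eqP-> /eqP->]; rewrite inE ?scaler0 ?addr0.
have [x /eqP//|K [_ KM Kmax]] := @maximal_submodule _ _ (Submodule zeroP) (lin_image j).
have [x xM xK|L [ML LK Lmax]] := @maximal_submodule _ _ (lin_image j) K.
  exact: KM.
pose sum := copair (submod_incl K) (submod_incl L).
pose fst := copair (submod_incl K) (\0 : {linear submod L -> E}).
have s_inj : injective sum.
  apply: raddf_inj => -[x y] e0.
  have {}e0 : submod_incl K x + submod_incl L y = 0 by [].
  have y0 : submod_incl L y = 0.
    apply: LK; first exact: submod_inclP.
    rewrite -[submod_incl L y](addKr (submod_incl K x)) e0 addr0 rpredN.
    exact: submod_inclP.
  move: e0; rewrite y0 addr0 => x0.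
  by congr (_, _); apply: submod_incl_inj; rewrite linear0.
have [g gE] := Einj _ _ sum fst s_inj.
have gK x : x \in K -> g x = x.
  move=> xK; have := gE (exist _ x xK, 0).
  by rewrite /sum /fst /= !addr0.
have gL x : x \in L -> g x = 0.
  move=> xL; have := gE (0, exist _ x xL).
  by rewrite /sum /fst /= add0r addr0.
have kerL : {subset lin_kernel g <= L}.
  apply: Lmax => [x /gL|x]; rewrite in_lin_kernel => /eqP // gx xK.
  by rewrite -(gK x).
have imK : {subset lin_image g <= K}.
  apply: Kmax => [x /gK xE|y /in_lin_image[x xy] yM].
    by apply/in_lin_image; exists x.
  (* [S] is the preimage under [g] of the image of [M]. It contains [L] and meets [K] trivially, so
     it lies in [L], where [g] vanishes. *)
  pose S := lin_kernel (quot_proj (lin_image j) \o g)%FUN.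
  have inS z : z \in S <-> g z \in lin_image j.
    by rewrite in_lin_kernel -quot_proj_eq0; split=> /eqP.
  apply: contrapT => y0; apply: y0.
  suff SL : {subset S <= L} by rewrite -xy gL //; apply/SL/inS; rewrite xy.
  apply: Lmax => [z zL|z /inS zS zK]; first by apply/inS; rewrite gL // rpred0.
  by apply: KM => //; rewrite -(gK z).
have [x|i iE] := @submod_corestrict _ _ L _ j.
  by apply/ML/in_lin_image; exists x.
exists (submod L), i; split; last split.
- move=> A B a f a_inj.
  have [h hE] := Einj _ _ a (submod_incl L \o f)%FUN a_inj.
  (* The map x - g x projects [E] onto [L]; it turns the extension [h] into one with values in
     [L]. *)
  have hL : linear (fun x => h x - g (h x)).
    by move=> r x y; rewrite 2!linearP scalerBr opprD addrACA.
  have [x|h' h'E] := @submod_corestrict _ _ L _ (mk_linear hL).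
    apply: kerL; rewrite in_lin_kernel /= linearB [g (g _)]gK ?subrr //.
    by apply/imK/in_lin_image; exists (h x).
  exists h' => x; apply: submod_incl_inj.
  by rewrite h'E /= hE [X in _ - X]gL ?subr0 //; apply: submod_inclP.
- by move=> x y e; apply: j_inj; rewrite -!iE e.
move=> S Ssub [x xS x0].
(* If [S] met the image of [M] only in 0, so would K + S; maximality of [K] would then put [S]
   inside both [K] and [L]. *)
apply: contrapT => noM; case/eqP: x0; apply: submod_incl_inj; rewrite linear0.
apply: (LK); first exact: submod_inclP.
(* [D] is the submodule K + S. *)
pose D : {pred E} := fun y => `[< exists2 s, s \in S & y - submod_incl L s \in K >].
have Dsub : submod_closed D.
  split=> [|a y z /asboolP[s sS ys] /asboolP[t tS zt]]; apply/asboolP.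
    by exists 0; [case: Ssub|rewrite (linear0 (submod_incl L)) subr0 rpred0].
  exists (a *: s + t); first by case: Ssub => _; apply.
  by rewrite (linearP (submod_incl L)) opprD addrACA -scalerBr rpredD // rpredZ.
suff : {subset Submodule Dsub <= K}.
  apply; apply/asboolP; exists x => //; by rewrite subrr rpred0.
apply: Kmax => [y yK|y /asboolP[s sS ys] yM].
  by apply/asboolP; exists 0; [case: Ssub|rewrite (linear0 (submod_incl L)) subr0].
have /eqP : y - submod_incl L s = 0.
  by apply: LK => //; rewrite rpredB //; [apply: ML|apply: submod_inclP].
rewrite subr_eq0 => /eqP ysE; have /in_lin_image[m my] := yM.
have ims : i m = s by apply: submod_incl_inj; rewrite iE my.
apply/eqP/negP => /negP y0; apply: noM; exists m; rewrite ims //.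
by apply: contra y0 => /eqP s0; rewrite ysE s0 (linear0 (submod_incl L)).
Qed.

End Envelope.

(** * The group Q/Z as an injective cogenerator of abelian groups *)

Definition QmodZ_pi : {additive rat -> QmodZ}.
Proof.
apply: (@mk_additive rat QmodZ \pi_(Quotient.quot rat_int)).
by move=> x y; rewrite [LHS]pi_addr.
Defined.

Lemma QmodZ_pi_surj : surjective_map QmodZ_pi.
Proof. by move=> q; exists (repr (q : Quotient.quot rat_int)); apply: reprK. Qed.

Lemma QmodZ_pi_eq0 x : QmodZ_pi x = 0 <-> x \is a Num.int.
Proof.
rewrite -(raddf0 QmodZ_pi) -[x \is a _]/(x \in rat_int) -{2}[x]subr0.
by rewrite Quotient.idealrBE; split=> [e|/eqP//]; apply/eqP.
Qed.

Lemma QmodZ_divisible (n : nat) (q : QmodZ) :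
  (0 < n)%N -> exists q', q' *+ n = q.
Proof.
move=> n0; have [x <-] := QmodZ_pi_surj q.
exists (QmodZ_pi (x / n%:R)); rewrite -raddfMn -[_ *+ n]mulr_natr divfK //.
by rewrite Num.Theory.pnatr_eq0 -lt0n.
Qed.

Section CharacterExtension.
Variable B : zmodType.
Local Notation V := ((zmodule B * zmodule QmodZ)%type : lmodType int).

(** A subgroup of B x Q/Z with this property is the graph of a character of a subgroup of [B]. *)
Definition functional_rel (C : {pred V}) := forall q, ((0, q) : V) \in C -> q = 0.

Lemma functional_rel_uniq (C : submodule V) : functional_rel C ->
  forall c v v', ((c, v) : V) \in C -> ((c, v') : V) \in C -> v = v'.
Proof.
move=> Cfun c v v' cv cv'; apply/eqP; rewrite -subr_eq0; apply/eqP/Cfun.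
by rewrite -[0](subrr c); apply: (rpredB cv cv').
Qed.

(** Finds a value for [b] compatible with [C]. If [n] is the least positive integer with n b in the
    domain of [C], divisibility of Q/Z gives [q] with n q equal to the value at n b; minimality of
    [n] makes every other admissible [k] a multiple of [n]. *)
Lemma character_order_value (C : submodule V) (b : B) : functional_rel C ->
  exists q : QmodZ, forall (k : int) v, ((b *~ k, v) : V) \in C -> v = q *~ k.
Proof.
move=> Cfun; have Cuniq := functional_rel_uniq Cfun.
pose D n := `[< (0 < n)%N /\ exists v, ((b *+ n, v) : V) \in C >].
have [exD|noD] := pselect (exists n, D n); last first.
  (* No n > 0 has n b in the domain of [C], so only k = 0 arises and any [q] would do. *)
  exists 0 => k v kv; rewrite mul0rz.
  have [k0|k0] := eqVneq k 0; first by apply: Cfun; move: kv; rewrite k0 mulr0z.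
  case: noD; exists `|k|%N; apply/asboolP; split; first by rewrite absz_gt0.
  case: k kv {k0} => n; first by exists v.
  by rewrite NegzE mulrNz => nv; exists (- v); rewrite -[b *+ _]opprK; apply: (rpredNr nv).
case: (ex_minnP exD) => n /asboolP[n0 [vn nvn]] nmin.
have [q qn] := QmodZ_divisible vn n0.
exists q => k v kv; have kE := divz_eq k n.
have divC : ((b *~ ((k %/ n)%Z * n), q *~ ((k %/ n)%Z * n)) : V) \in C.
  rewrite mulrC !mulrzA -!pmulrn qn.
  exact: (rpredZ (k %/ n)%Z nvn).
have k_ge0 : (0 <= (k %% n)%Z) by rewrite modz_ge0 // -lt0n.
have k_ltn : ((k %% n)%Z < n) by rewrite ltz_pmod.
case Ek : (k %% n)%Z k_ge0 k_ltn => [r|//] _ rn.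
have [r0|r_gt0] := posnP r.
  apply: Cuniq kv _; rewrite kE Ek r0 addr0; exact: divC.
have : D r.
  apply/asboolP; split=> //; exists (v - q *~ ((k %/ n)%Z * n)).
  have -> : b *+ r = b *~ k - b *~ ((k %/ n)%Z * n).
    by rewrite {1}kE Ek mulrzDr addrAC subrr add0r.
  exact: (rpredB kv divC).
by move/nmin; rewrite leqNgt -ltz_nat rn.
Qed.

(** Being functional means meeting 0 x Q/Z trivially, so Zorn gives a maximal functional [C] above
    [A]. It is defined at every [b], since the value from [character_order_value] could be
    adjoined. *)
Lemma character_extension (A : submodule V) : functional_rel A ->
  exists chi : {additive B -> QmodZ}, forall b q, ((b, q) : V) \in A -> chi b = q.
Proof.
move=> Afun; pose vert : {pred V} := fun z => z.1 == 0.
have funP (C : {pred V}) : functional_rel C <-> meets_trivially C vert.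
  split=> [Cfun [c q] cq /eqP /= c0|CB q q0].
    by move: cq; rewrite c0 => /Cfun->.
  have : ((0, q) : V) = 0 by apply: CB => //; apply/eqP.
  by case.
have [C [AC /funP Cfun Cmax]] := maximal_submodule (iffLR (funP A) Afun).
have Ctot b : exists q, ((b, q) : V) \in C.
  have [q qP] := character_order_value b Cfun; exists q.
  (* [D] is [C] with the integer multiples of (b, q) adjoined. *)
  pose D : {pred V} := fun z => `[< exists k : int, z - k *: ((b, q) : V) \in C >].
  have Dsub : submod_closed D.
    split=> [|a x y /asboolP[k xk] /asboolP[l yl]]; apply/asboolP.
      by exists 0; rewrite scale0r subr0 rpred0.
    exists (a * k + l); rewrite scalerDl opprD addrACA -scalerA -scalerBr.
    by rewrite rpredD // rpredZ.
  apply: (Cmax (Submodule Dsub)) => [x xC||].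
  - by apply/asboolP; exists 0; rewrite scale0r subr0.
  - apply/funP => v /asboolP[k vk].
    have : ((b *~ (- k), v - q *~ k) : V) \in C.
      by rewrite mulrNz -[- (b *~ k)]add0r.
    by move/qP; rewrite mulrNz => /(canRL (subrK _)); rewrite addNr.
  by apply/asboolP; exists 1; rewrite scale1r subrr rpred0.
have [chi chiP] := choice Ctot.
have Cuniq := functional_rel_uniq Cfun.
have chiD : {morph chi : x y / x + y}.
  by move=> x y; apply: Cuniq (chiP _) _; apply: (rpredD (chiP x) (chiP y)).
by exists (mk_additive chiD) => b q /AC; apply: Cuniq.
Qed.

End CharacterExtension.

(** The pairs (i x, f x) form a subgroup, functional because [i] is injective, to which
    [character_extension] applies. *)
Lemma character_lift (A B : zmodType) (i : {additive A -> B})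
    (f : {additive A -> QmodZ}) : injective i ->
  exists g : {additive B -> QmodZ}, forall x, g (i x) = f x.
Proof.
move=> i_inj; pose V : lmodType int := (zmodule B * zmodule QmodZ)%type.
pose S : {pred V} := fun z => `[< exists x, z = (i x, f x) >].
have Ssub : submod_closed S.
  split=> [|a _ _ /asboolP[x ->] /asboolP[y ->]]; apply/asboolP.
    by exists 0; rewrite !raddf0.
  by exists (x *~ a + y); rewrite !raddfD !raddfMz.
have [q /asboolP[x [/esym ix ->]]|g gE] := @character_extension B (Submodule Ssub).
  by rewrite (_ : x = 0) ?raddf0 //; apply: i_inj; rewrite raddf0.
by exists g => x; apply: gE; apply/asboolP; exists x.
Qed.

(** The class of 1/n in Q/Z, with [n] the order of [b], is a nonzero value that may be prescribed at
    [b]; this character of the cyclic group of [b] then extends to [B]. *)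
Lemma character_separates (B : zmodType) (b : B) :
  b != 0 -> exists chi : {additive B -> QmodZ}, chi b != 0.
Proof.
move=> b0; pose V : lmodType int := (zmodule B * zmodule QmodZ)%type.
have [n n_gt1 nP] : exists2 n : nat, (1 < n)%N & forall k : int, b *~ k = 0 -> (n %| k)%Z.
  have [exn|non] := pselect (exists n, (0 < n)%N && (b *+ n == 0)); last first.
    (* When [b] has infinite order, only k = 0 annihilates it and any n > 1 would do. *)
    exists 2 => // k /eqP bk; have [->|k0] := eqVneq k 0; first exact: dvdz0.
    case: non; exists `|k|%N; rewrite absz_gt0 k0 /=.
    by case: k bk {k0} => n //; rewrite NegzE mulrNz oppr_eq0.
  case: (ex_minnP exn) => n /andP[n0 /eqP bn] nmin; exists n => [|k bk].
    rewrite ltn_neqAle n0 andbT; apply: contra b0 => /eqP n1.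
    by rewrite -[b]mulr1n n1 bn.
  have : b *~ (k %% n)%Z = 0.
    move: bk; rewrite {1}(divz_eq k n) mulrzDr mulrC mulrzA -pmulrn bn mul0rz.
    by rewrite add0r.
  have k_ge0 : (0 <= (k %% n)%Z) by rewrite modz_ge0 // -lt0n.
  have k_ltn : ((k %% n)%Z < n) by rewrite ltz_pmod.
  case Ek : (k %% n)%Z k_ge0 k_ltn => [r|//] _ rn br.
  apply/dvdz_mod0P; rewrite Ek; have [->//|r0] := posnP r.
  by have := nmin r; rewrite r0 pmulrn br eqxx leqNgt -ltz_nat rn => /(_ isT).
pose q := QmodZ_pi (n%:R^-1).
have q0 : q != 0.
  apply/eqP => /QmodZ_pi_eq0/Num.Theory.intrP[z zn].
  have : (z * n = 1).
    apply: (@intr_inj rat); rewrite intrM -zn mulVf //.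
    by rewrite Num.Theory.pnatr_eq0 -lt0n ltnW.
  move/(congr1 absz); rewrite abszM /= => /eqP.
  by rewrite muln_eq1 => /andP[_ /eqP n1]; rewrite n1 in n_gt1.
have qP k : (n %| k)%Z -> q *~ k = 0.
  case/dvdzP=> m ->; rewrite -raddfMz; apply/QmodZ_pi_eq0.
  rewrite -mulrzl intrM mulfK ?rpred_int //.
  by rewrite Num.Theory.pnatr_eq0 -lt0n ltnW.
pose S : {pred V} := fun z => `[< exists k : int, z = (b *~ k, q *~ k) >].
have Ssub : submod_closed S.
  split=> [|a _ _ /asboolP[k ->] /asboolP[l ->]]; apply/asboolP; first by exists 0.
  by exists (k * a + l); rewrite !mulrzDr !mulrzA.
have [v /asboolP[k [/esym bk ->]]|chi chiE] := @character_extension B (Submodule Ssub).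
  exact/qP/nP.
exists chi; rewrite (chiE b q) //.
by apply/asboolP; exists 1.
Qed.

(** * Construction and generation of tensor products *)

Section Tensor.
Variables (R : pzRingType) (F : lmodType R^c) (A : lmodType R).

Definition balanced_uncurried (U : lmodType int) (h : F * A -> U) :=
  balanced (fun x a => h (x, a)).

(** Abelian groups are treated as modules over [int], so that the universal property of [presented]
    for balanced maps becomes that of the tensor product. *)
Definition tensor : lmodType int := presented balanced_uncurried.
Definition tens (x : F) (a : A) : tensor := presented_gen balanced_uncurried (x, a).

Lemma tensorP : is_tensor tens.
Proof.
split=> [|U b bB].
  split=> [x y a|x a b|r x a]; apply: presented_map_ext => U h hB;
    have [hDl hDr hZ] := hB; rewrite ?(raddfD (presented_map hB)) [LHS]presented_mapE.
  - by rewrite [LHS]hDl; congr (_ + _); apply/esym/presented_mapE.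
  - by rewrite [LHS]hDr; congr (_ + _); apply/esym/presented_mapE.
  - by rewrite [LHS]hZ; apply/esym/presented_mapE.
have bB' : balanced_uncurried (fun p : F * A => b p.1 p.2 : zmodule U) by [].
exists (mk_additive (raddfD (presented_map bB')) : {additive tensor -> U}).
split=> [x a|v vE z]; first exact: presented_mapE bB' (x, a).
rewrite -[RHS]/(presented_map bB' z).
have [w ->] := presented_sum z.
rewrite (raddf_sum v) (linear_sum (presented_map bB')); apply: eq_bigr => -[k [x a]] _.
rewrite linearZ presented_mapE /= -[k in LHS]intz scaler_int raddfMz.
by congr (_ *~ _); apply: vE.
Qed.

(* Any tensor product is spanned by the pure tensors, being a retract of
   [tensor]. *)
Lemma is_tensor_sum (T : zmodType) (t : F -> A -> T) : is_tensor t ->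
  forall z : T, exists w : seq (int * (F * A)),
    z = \sum_(p <- w) t p.2.1 p.2.2 *~ p.1.
Proof.
move=> [tB tU] z; have [tensB tensU] := tensorP.
have [u [uE _]] := tU _ _ tensB; have [v [vE _]] := tensU _ _ tB.
have [i [_ iU]] := tU _ _ tB.
have vuD : {morph (fun z => v (u z)) : x y / x + y} by move=> x y; rewrite !raddfD.
(* Both v u and the identity induce [t] on pure tensors, so both equal the unique such map [i]. *)
have vuK : v (u z) = z.
  transitivity (i z); first by apply: (iU (mk_additive vuD)) => x a /=; rewrite uE.
  by rewrite -(iU idfun).
have [w wE] := presented_sum (u z); exists w.
rewrite -vuK wE raddf_sum; apply: eq_bigr => -[k [x a]] _ /=.
by rewrite -[k in LHS]intz scaler_int raddfMz -vE.
Qed.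

End Tensor.

(** By adjunction a map from [A] to F^+ is a character of F (x) A. Flatness embeds F (x) A in F (x)
    B, the character extends there, and adjunction turns it back into a map from [B] to F^+. *)
Lemma flat_character_injective (R : pzRingType) (F : lmodType R^c) :
  flat F -> injective_module (character F : lmodType R).
Proof.
move=> Fflat A B i f i_inj.
have [[tDl tDr tZ] tB] := tensorP F B; have [_ tA] := tensorP F A.
have ibal : balanced (fun x a => tens x (i a) : tensor F B).
  split=> [x y a|x a b|r x a]; rewrite ?linearD ?linearZ //=.
have [g [gE _]] := tA _ _ ibal.
have fbal : balanced (fun x a => char_fun (f a) x).
  split=> [x y a|x a b|r x a]; rewrite ?linearD ?linearZ //=.
  by rewrite /char_fun raddfD.
have [fT [fTE _]] := tA _ _ fbal.
have g_inj := Fflat _ _ i i_inj _ _ _ _ (tensorP F A) (tensorP F B) g gE.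
have [h hE] := character_lift fT g_inj.
have hD b : {morph (fun x => h (tens x b)) : x y / x + y}.
  by move=> x y; rewrite tDl raddfD.
pose k b : character F := mk_additive (hD b).
have kL : linear k.
  move=> r b c; apply: charP => x.
  rewrite -[LHS]/(h (tens x (r *: b + c))) tDr (raddfD h) -tZ.
  by [].
exists (mk_linear kL) => a; apply: charP => x.
by rewrite -[LHS]/(h (tens x (i a))) -gE hE fTE.
Qed.

(** * Coordinates and flatness of free modules *)

Section FreeFlat.
Variables (R : pzRingType) (G : choiceType).

Definition free_coord (s : G) : {linear free_mod R G -> R^o} :=
  free_map (fun g => (g == s)%:R : R^o).

Lemma free_coord_gen s a g :
  free_coord s (a *: free_gen R g) = (a * (g == s)%:R : R).
Proof. by rewrite linearZ free_mapE. Qed.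

(** The expansion is stated for every large enough duplicate-free list so that the two summands in
    the induction can share one index list. *)
Lemma free_coord_sum (x : free_mod R G) : exists r : seq G,
  forall r', uniq r' -> {subset r <= r'} ->
    x = \sum_(s <- r') (free_coord s x : R) *: free_gen R s.
Proof.
have [w ->] := free_sum x; elim: w => [|[a g] w [r rP]].
  exists [::] => r' _ _; rewrite big_nil big1 // => s _.
  by rewrite linear0 scale0r.
exists (g :: r) => r' r'U sub.
rewrite big_cons {1}(rP r') // => [|s sr]; last by apply: sub; rewrite inE sr orbT.
under [RHS]eq_bigr do rewrite linearD scalerDl.
rewrite big_split; congr (_ + _).
rewrite (bigD1_seq g) ?sub ?mem_head // big1 => [|s sg].
  by rewrite free_coord_gen eqxx mulr1 [RHS]addr0.
by rewrite free_coord_gen eq_sym (negbTE sg) mulr0 scale0r.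
Qed.

End FreeFlat.

(* Every element of a tensor product of the free module with [A] is uniquely
   a finite sum of [e_s (x) a_s], the [a_s] being read off by [phi s]. *)
Lemma free_flat (R : pzRingType) (G : choiceType) : flat (free_mod R^c G).
Proof.
move=> A B f f_inj TA TB tA tB TAP TBP g gE.
(* Multiplying [a] by the coordinate of [x] at [s] is balanced; it induces [phi s] from [TA] to [A],
   and likewise [psi s] on [TB]. *)
have coord_bal (C : lmodType R) s :
    balanced (fun (x : free_mod R^c G) (a : C) => (free_coord R^c s x : R) *: a).
  split=> [x y a|x a b|r x a]; first by rewrite linearD scalerDl.
    by rewrite scalerDr.
  by rewrite linearZ scalerA.
have [[tDl tDr tZ] TAU] := TAP; have [_ TBU] := TBP.
have [phi phiE] := choice (fun s => TAU _ _ (coord_bal A s)).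
have [psi psiE] := choice (fun s => TBU _ _ (coord_bal B s)).
pose spans (z : TA) := exists r : seq G, forall r', uniq r' ->
  {subset r <= r'} -> z = \sum_(s <- r') tA (free_gen R^c s) (phi s z).
have tA0 x : tA x 0 = 0 by apply: (addrI (tA x 0)); rewrite -tDr !addr0.
have t0A a : tA 0 a = 0 by apply: (addrI (tA 0 a)); rewrite -tDl !addr0.
have tAMz x a k : tA x (a *~ k) = tA x a *~ k.
  by rewrite -[RHS](raddfMz (mk_additive (tDr x))).
have tA_sum a (l : seq G) (v : G -> free_mod R^c G) :
    tA (\sum_(s <- l) v s) a = \sum_(s <- l) tA (v s) a.
  exact: (raddf_sum (@mk_additive _ _ (tA^~ a) (fun x y => tDl x y a))).
have spans_all z : spans z.
  have [w ->] := is_tensor_sum TAP z.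
  apply: (big_ind spans) => [|y z' [r rP] [r' r'P]|[k [x a]] _ /=].
  - by exists [::] => r' _ _; rewrite big1 // => s _; rewrite raddf0 tA0.
  - exists (r ++ r') => l lU sub.
    rewrite {1}(rP l) // => [|s sr]; last by apply: sub; rewrite mem_cat sr.
    rewrite {1}(r'P l) // => [|s sr]; last by apply: sub; rewrite mem_cat sr orbT.
    by rewrite -big_split; apply: eq_bigr => s _; rewrite raddfD tDr.
  have [r rP] := free_coord_sum x; exists r => l lU sub.
  rewrite {1}(rP l lU sub) tA_sum.
  rewrite mulrz_suml; apply: eq_bigr => s _.
  by rewrite raddfMz tAMz (phiE s).1 -tZ.
apply: raddf_inj => z gz0; have [r rP] := spans_all z.
rewrite (rP (undup r)) ?undup_uniq // => [|s]; last by rewrite mem_undup.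
rewrite big1 // => s _; rewrite (_ : phi s z = 0) //.
apply: f_inj; rewrite linear0.
(* Reading coordinates commutes with [f]: f (phi s z) = psi s (g z), as checked on pure tensors. *)
transitivity (psi s (g z)); last by rewrite gz0 raddf0.
have [w ->] := is_tensor_sum TAP z.
rewrite !raddf_sum; apply: eq_bigr => -[k [x a]] _ /=.
by rewrite !raddfMz gE (phiE s).1 (psiE s).1; congr (_ *~ _); apply: linearZ_LR.
Qed.

(** * Embedding a module in the character module of a flat module *)

Section FlatEmbedding.
Variables (R : pzRingType) (M : lmodType R).

(* [R^c^c] and [R] have the same operations but are not convertible as
   structures, hence this copy of [M]. *)
Definition conv2 : Type := M.
HB.instance Definition _ := GRing.Zmodule.on conv2.
Definition conv2_scale (r : R^c^c) (x : conv2) : conv2 := (r : R) *: (x : M).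

Lemma conv2_scaleA a b x : conv2_scale a (conv2_scale b x) = conv2_scale (a * b) x.
Proof. exact: scalerA. Qed.

Lemma conv2_scale1 : left_id 1 conv2_scale.
Proof. exact: scale1r. Qed.

Lemma conv2_scaleDr : right_distributive conv2_scale +%R.
Proof. by move=> a x y; apply: scalerDr. Qed.

Lemma conv2_scaleDl x : {morph conv2_scale^~ x : a b / a + b}.
Proof. by move=> a b; apply: scalerDl. Qed.

HB.instance Definition _ := GRing.Zmodule_isLmodule.Build R^c^c conv2
  conv2_scaleA conv2_scale1 conv2_scaleDr conv2_scaleDl.

(** [j] is the evaluation of [M] into M^++ followed by the dual of the surjection [e] from F onto
    M^+. If j m = 0, every character of [M] kills m, since each has the form e x; hence m = 0. *)
Lemma flat_character_embedding : exists2 F : lmodType R^c, flat F &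
  exists j : {linear M -> (character F : lmodType R)}, injective j.
Proof.
pose Mplus : lmodType R^c := character conv2.
pose F := free_mod R^c Mplus; pose e : {linear F -> Mplus} := free_cover Mplus.
exists F; first exact: free_flat.
have jD (m : M) : {morph (fun x : F => char_fun (e x) m) : x y / x + y}.
  by move=> x y; rewrite linearD.
pose j m : character F := mk_additive (jD m).
have jL : linear j.
  move=> r m m'; apply: charP => x.
  rewrite -[LHS]/(char_fun (e x) (r *: m + m')) /char_fun raddfD; congr (_ + _).
  by rewrite -[RHS]/(char_fun (e ((r : R^c) *: x)) m) linearZ.
exists (mk_linear jL); apply: raddf_inj => m jm0.
apply/eqP/negP => /negP m0.
have [chi chim] := @character_separates conv2 m m0.
case/eqP: chim; have [x ex] := free_cover_surj (chi : Mplus).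
by have /(congr1 (fun c => char_fun c x)) := jm0; rewrite -[LHS]/(char_fun (e x) m) ex.
Qed.

End FlatEmbedding.

(** * The cycle of implications between the five conditions *)

Theorem proposition2p8 (R : pzRingType) (X : lmodType R -> Prop)
    (X_precovering : precovering X)
    (X_iso : closed_iso X)
    (X_sums : closed_finite_direct_sums X)
    (X_summands : closed_direct_summands X)
    (M : lmodType R) :
  [<-> exists2 X0 : lmodType R, X X0 & exists i : {linear M -> X0}, injective i;
       exists M' : lmodType R, forall N : lmodType R,
         perp M' N -> completing_domain X M N;
       forall E : lmodType R, injective_module E -> completing_domain X M E;
       exists (E : lmodType R) (i : {linear M -> E}),
         injective_envelope i /\ completing_domain X M E;
       forall F : lmodType R^c, flat F -> completing_domain X M (character F)].
Proof.
have c12 : (exists2 X0 : lmodType R, X X0 & exists i : {linear M -> X0}, injective i) ->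
    exists M' : lmodType R, forall N : lmodType R,
      perp M' N -> completing_domain X M N.
  move=> [X0 XX0 [i i_inj]]; exists (quotmod (lin_image i)) => N extN f X1 g [_ gP].
  have [f' f'E] := Ext1_extension f i_inj extN; have [h hE] := gP _ XX0 f'.
  by exists (h \o i)%FUN => x; rewrite /= hE.
have c23 : (exists M' : lmodType R, forall N : lmodType R,
      perp M' N -> completing_domain X M N) ->
    forall E : lmodType R, injective_module E -> completing_domain X M E.
  by move=> [M' M'P] E Einj; apply/M'P/injective_Ext1_eq0.
have embed (E : lmodType R) (j : {linear M -> E}) : injective j ->
    completing_domain X M E ->
    exists2 X0 : lmodType R, X X0 & exists i : {linear M -> X0}, injective i.
  move=> j_inj ME; have [X0 [g gP]] := X_precovering E; have [h hE] := ME j X0 g gP.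
  by exists X0; [case: gP|exists h => x y e; apply: j_inj; rewrite -!hE e].
have [F0 F0flat [j j_inj]] := flat_character_embedding M.
tfae => //.
- move=> c3; have [L [i iP]] := injective_envelope_exists (flat_character_injective F0flat) j_inj.
  by exists L, i; split=> //; apply: c3; case: iP.
(* From (4) to (5) the path leads through (1): the envelope map is injective, so [embed] applies,
   and (3) then covers the injective module F^+. *)
- move=> [E [i [[_ [i_inj _]] ME]]] F Fflat.
  exact: c23 (c12 (embed _ i i_inj ME)) _ (flat_character_injective Fflat).
- by move=> c5; apply: embed j_inj (c5 _ F0flat).
Qed.
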